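(* For every ideal $\mathcal{I}$ on $\omega$, $\mathfrak{b}(\mathcal{I})\leq\mathfrak{b}_R(\mathcal{I})$.
   Context: An ideal on a countable infinite set $X$ is a nonempty family $\mathcal{I}\subseteq\mathcal{P}(X)$ closed under finite unions and under subsets, containing all finite subsets of $X$, and with $X\notin\mathcal{I}$; $\mathcal{I}^+=\mathcal{P}(X)\setminus\mathcal{I}$. $\mathcal{D}_\mathcal{I}$ is the set of functions $f:X\to\omega$ with $f^{-1}(\{n\})\in\mathcal{I}$ for all $n$. $\mathfrak{b}(\mathcal{I})$ is the least cardinality of a family $\mathcal{F}\subseteq\mathcal{D}_\mathcal{I}$ such that for every $g\in\mathcal{D}_\mathcal{I}$ there is $f\in\mathcal{F}$ with $\{x\in X: f(x)<g(x)\}\notin\mathcal{I}$. Families $\mathcal{A},\mathcal{B}\subseteq\mathcal{P}(X)$ are $\mathcal{I}$-orthogonal if $A\cap B\in\mathcal{I}$ for all $A\in\mathcal{A}$, $B\in\mathcal{B}$. A set $C\subseteq X$ $\mathcal{I}$-separates $(\mathcal{A},\mathcal{B})$ if $A\cap C\in\mathcal{I}$ and $B\setminus C\in\mathcal{I}$ for all $A\in\mathcal{A}$, $B\in\mathcal{B}$. An $\mathcal{I}$-gap is a pair $(\mathcal{A},\mathcal{B})$ of $\mathcal{I}$-orthogonal subfamilies of $\mathcal{I}^+$ not $\mathcal{I}$-separated by any $C\subseteq X$; it is an $\mathcal{I}$-$(\kappa,\lambda)$-gap if $|\mathcal{A}|=\kappa$, $|\mathcal{B}|=\lambda$. The Rothberger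 number $\mathfrak{b}_R(\mathcal{I})$ is the least $\kappa$ such that there is an $\mathcal{I}$-$(\omega,\kappa)$-gap, and $\mathfrak{c}^+$ if none exists. *)

(* Defs.v *)
From HB Require Import structures.
From mathcomp Require Import all_boot.
From mathcomp Require Import boolp classical_sets functions cardinality.

Set Implicit Arguments.
Unset Strict Implicit.
Unset Printing Implicit Defensive.

Local Open Scope classical_set_scope.
Local Open Scope card_scope.

(** * Cardinals

  A cardinal is represented by a set of that cardinality, drawn from the type
  [set (set nat)] of size 2^c. Every cardinal up to 2^c, in particular c^+, is
  represented; comparison is [#<=] and equality is [#=]. *)

Definition cardinal := set (set (set nat)).

Definition is_least_card (P : set cardinal) (K : cardinal) : Prop :=
  P K /\ forall L, P L -> K #<= L.

(* Determined up to [#=]. The default [set0] is never used for a nonempty [P]: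
   see [least_cardP]. *)
Definition least_card (P : set cardinal) : cardinal :=
  xget set0 (is_least_card P).

Definition continuum_succ : cardinal :=
  least_card [set K | [set: set nat] #<= K /\ ~ (K #<= [set: set nat])].

(** * Ideals on omega and their cardinal invariants *)

Record is_ideal (I : set (set nat)) : Prop := IsIdeal {
  ideal_nonempty : I !=set0 ;
  ideal_setU : forall A B, I A -> I B -> I (A `|` B) ;
  ideal_subset : forall A B, A `<=` B -> I B -> I A ;
  ideal_finite : forall A, finite_set A -> I A ;
  ideal_proper : ~ I [set: nat]
}.

Definition positive (I : set (set nat)) : set (set nat) := ~` I.

Definition DI (I : set (set nat)) : set (nat -> nat) :=
  [set f | forall n, I (f @^-1` [set n])].

Definition unbounded_family (I : set (set nat)) (F : set (nat -> nat)) : Prop :=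
  F `<=` DI I /\
  forall g, DI I g -> exists2 f, F f & ~ I [set x | (f x < g x)%N].

Definition bI (I : set (set nat)) : cardinal :=
  least_card [set K | exists2 F, unbounded_family I F & F #= K].

Definition orthogonal (I A B : set (set nat)) : Prop :=
  forall a b, A a -> B b -> I (a `&` b).

Definition separates (I : set (set nat)) (C : set nat) (A B : set (set nat))
    : Prop :=
  (forall a, A a -> I (a `&` C)) /\ (forall b, B b -> I (b `\` C)).

Definition gap (I A B : set (set nat)) : Prop :=
  [/\ A `<=` positive I, B `<=` positive I, orthogonal I A B
    & ~ exists C, separates I C A B].

Definition card_gap (T U : Type) (I : set (set nat)) (K : set T) (L : set U)
    : Prop :=
  exists A B, [/\ gap I A B, A #= K & B #= L].

Definition omega_gap_cards (I : set (set nat)) : set cardinal :=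
  [set K | card_gap I [set: nat] K].

Definition bR (I : set (set nat)) : cardinal :=
  if `[< omega_gap_cards I !=set0 >] then least_card (omega_gap_cards I)
  else continuum_succ.

(** * The least cardinals above exist *)

(* Hoenig's argument: a maximal family of choice functions on [P] that pairwise
   differ at every coordinate projects onto some coordinate. *)
Lemma least_card_exists (P : set cardinal) :
  P !=set0 -> exists K, is_least_card P K.
Proof.
move=> P0.
pose Q (S : set (cardinal -> set (set nat))) :=
  (forall s K, S s -> P K -> K (s K)) /\
  (forall s t K, S s -> S t -> P K -> s K = t K -> s = t).
have [|S [[Sin Sinj] Smax]] := @Zorn_bigcup _ Q.
  move=> F FQ Ftot; split=> [s K [X FX Xs]|s t K [X FX Xs] [Y FY Yt]].
    exact: (FQ X FX).1.
  have [XY|YX] := Ftot X Y FX FY.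
    by apply: (FQ Y FY).2 => //; exact: XY.
  by apply: (FQ X FX).2 => //; exact: YX.
have [K PK Ksurj] : exists2 K, P K & forall y, K y -> exists2 s, S s & s K = y.
  apply: contrapT => nK.
  have miss K : exists y, P K -> K y /\ forall s, S s -> s K <> y.
    have [PK|nPK] := pselect (P K); last by exists set0.
    apply: contrapT => ny; apply: nK; exists K => // y Ky.
    apply: contrapT => ns; apply: ny; exists y => _; split=> // s Ss sKy.
    by apply: ns; exists s.
  have [s0 s0P] := choice miss.
  apply: (Smax (S `|` [set s0])).
    split; first exact: subsetUl.
    have [K PK] := P0 => /(_ s0 (or_intror erefl)) Ss0.
    exact: (s0P K PK).2 Ss0 erefl.
  split=> [s K [Ss|->]|s t K [Ss|->] [St|->] PK //].
  - exact: Sin.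
  - by move=> /s0P[].
  - exact: Sinj.
  - by move=> e; case: ((s0P K PK).2 s Ss e).
  - by move=> e; case: ((s0P K PK).2 t St (esym e)).
have SK L : P L -> (fun s : cardinal -> set (set nat) => s L) @` S #= S.
  move=> PL; apply: inj_card_eq => s t; rewrite !inE => Ss St.
  exact: Sinj.
exists K; split=> // L PL; have {}SK := SK L PL.
apply: (@card_le_trans _ _ _ S K L).
  apply: card_le_trans (card_image_le (fun s : cardinal -> _ => s K) S).
  by apply: subset_card_le => y /Ksurj[s Ss <-]; exists s.
move: SK; rewrite card_eq_sym card_eq_le => /andP[SL _].
apply: (card_le_trans SL); apply: subset_card_le => _ [s Ss <-].
exact: (Sin s L).
Qed.

Lemma least_cardP (P : set cardinal) :
  P !=set0 -> is_least_card P (least_card P).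
Proof. by move=> /least_card_exists; exact: xgetPex. Qed.

Lemma set1_inj (T : Type) : injective (@set1 T).
Proof. by move=> x y xy; have : [set y] x by rewrite -xy. Qed.

Lemma continuum_succP :
  is_least_card [set K | [set: set nat] #<= K /\ ~ (K #<= [set: set nat])]
    continuum_succ.
Proof.
apply: least_cardP; exists setT; split.
  have /card_esym := @inj_card_eq _ _ setT _ (in2W (@set1_inj (set nat))).
  rewrite card_eq_le => /andP[h _]; exact: card_le_trans h (card_leT _).
move=> /pcard_leP[f].
pose D := [set f A | A in [set A | ~ A (f A)]].
have [Df|nDf] := pselect (D (f D)); last by apply: (nDf); exists D.
have [A nA] := Df => /(@inj _ _ _ f) AD; apply: nA.
by rewrite AD ?inE.
Qed.

Lemma inj_cardinal (T : Type) (j : T -> set (set nat)) (F : set T) :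
  injective j -> exists K : cardinal, F #= K.
Proof.
move=> jinj; exists (j @` F); rewrite card_eq_sym.
by apply: inj_card_eq => x y _ _; exact: jinj.
Qed.

Lemma unbounded_DI (I : set (set nat)) : is_ideal I -> unbounded_family I (DI I).
Proof.
move=> idI; split=> // g gD; exists (fun x => (g x).-1).
  move=> n; apply: (ideal_subset idI _
    (ideal_setU idI (gD n.+1) (ideal_setU idI (gD 0) (gD n)))).
  by move=> x /=; case: (g x) => [|m] /= ->; [right; left|left].
move=> Ilt; apply: (ideal_proper idI).
apply: (ideal_subset idI _ (ideal_setU idI Ilt (gD 0))) => x _ /=.
by case: (g x) => [|m]; [right|left].
Qed.

Lemma bIP (I : set (set nat)) : is_ideal I ->
  is_least_card [set K | exists2 F, unbounded_family I F & F #= K] (bI I).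
Proof.
move=> /unbounded_DI DU; apply: least_cardP.
pose j (f : nat -> nat) := range (fun n => [set pickle (n, f n)]).
have [f g jfg|K DK] := @inj_cardinal _ j (DI I); last by exists K, (DI I).
apply/funext => n.
have [m _ /(@set1_inj nat) /(pcan_inj (@pickleK _))[-> ->] //] : j g [set pickle (n, f n)].
by rewrite -jfg; exists n.
Qed.

Lemma bR_gapP (I A B : set (set nat)) : gap I A B -> A #= [set: nat] ->
  is_least_card (omega_gap_cards I) (bR I).
Proof.
move=> gAB Aw; have [K BK] := @inj_cardinal _ _ B (@set1_inj (set nat)).
have ne : omega_gap_cards I !=set0 by exists K, A, B.
by rewrite /bR asboolT//; exact: least_cardP.
Qed.

(* Main.v *)
(** Let [(A, B)] be a gap with [A = {a_0, a_1, ...}], and let [h x] be the least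
  [n] with [x] in [a_n]. Orthogonality makes the function equal to [h] on
  [b `&` \bigcup_n a_n] and to the identity elsewhere a member of [DI I], for
  each [b] in [B]. If some [g] in [DI I] bounded all these functions modulo
  [I], then the set of the [x] that lie in no [a_n] with [n < g x] would
  separate the gap; hence they form an unbounded family indexed by [B]. *)

Require Import Defs.
From mathcomp Require Import all_boot.
From mathcomp Require Import boolp classical_sets functions cardinality.

Local Open Scope classical_set_scope.
Local Open Scope card_scope.

Lemma card_eq_natP (T : pointedType) (A : set T) :
  A #= [set: nat] -> exists a : nat -> T, range a = A.
Proof.
rewrite card_eq_sym => /card_set_bijP[a [fA _ aA]].
by exists a; apply/seteqP; split=> [_ [n _ <-]|x /aA //]; exact: fA.
Qed.

(** A function is determined by its graph, which [pickle] codes as a set of naturals. *)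
Lemma card_le_fun_nat (F : set (nat -> nat)) : F #<= [set: set nat].
Proof.
pose graph (f : nat -> nat) := range (fun n => pickle (n, f n)).
have graph_inj : injective graph.
  move=> f g fg; apply/funext => n.
  have [m _ /(pcan_inj (@pickleK _))[-> ->] //] : graph g (pickle (n, f n)).
  by rewrite -fg; exists n.
have := @inj_card_eq _ _ F graph (in2W graph_inj).
rewrite card_eq_sym card_eq_le => /andP[Fg _].
exact: card_le_trans Fg (card_leT _).
Qed.

Lemma ideal_preimage_le {I : set (set nat)} (idI : is_ideal I) {g : nat -> nat} n :
  DI I g -> I [set x | (g x <= n)%N].
Proof.
move=> gD; elim: n => [|n IHn].
  by apply: ideal_subset (gD 0) => // x /=; rewrite leqn0 => /eqP.
apply: (ideal_subset idI _ (ideal_setU idI IHn (gD n.+1))) => x /=.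
by rewrite leq_eqVlt ltnS => /orP[/eqP|]; [right|left].
Qed.

Section gap_functions.
Variables (I : set (set nat)) (a : nat -> set nat).

(** The default [x] off the union of the [a n] adds at most one point to each fibre, which no ideal
    notices. *)
Definition first_index (x : nat) : nat :=
  if pselect (exists n, `[< a n x >]) is left ex then ex_minn ex else x.

Definition gap_fun (b : set nat) (x : nat) : nat :=
  if `[< b x >] then first_index x else x.

Lemma first_indexP x :
  a (first_index x) x \/ first_index x = x.
Proof.
rewrite /first_index; case: pselect => [ex|_]; last by right.
by case: ex_minnP => n /asboolP; left.
Qed.

Lemma first_index_le n x : a n x -> (first_index x <= n)%N.
Proof.
move=> anx; rewrite /first_index; case: pselect => [ex|[]].
  by case: ex_minnP => m _; apply; apply/asboolP.
by exists n; apply/asboolP.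
Qed.

(** Every point of the fibre over [n], other than [n] itself, lies in both [a n] and [b]. *)
Lemma gap_fun_DI b : is_ideal I -> (forall n, I (a n `&` b)) ->
  DI I (gap_fun b).
Proof.
move=> idI ab n.
have I1 : I [set n] by apply: ideal_finite => //; exact: finite_set1.
apply: (ideal_subset idI _ (ideal_setU idI (ab n) I1)) => x /=.
rewrite /gap_fun; case: asboolP => [bx <-|_]; last by right.
by case: (first_indexP x) => [ax|->]; [left|right].
Qed.

Lemma gap_fun_unbounded (B : set (set nat)) : is_ideal I ->
  gap I (range a) B -> unbounded_family I (gap_fun @` B).
Proof.
move=> idI [_ _ orth nsep]; split=> [_ [b Bb <-]|g gD].
  by apply: gap_fun_DI => // n; apply: orth => //; exists n.
apply: contrapT => bounded; apply: nsep.
exists [set x | forall n, a n x -> (g x <= n)%N]; split=> [_ [n _ <-]|b Bb].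
  apply: (ideal_subset idI _ (ideal_preimage_le idI n gD)) => x [anx].
  exact.
have Ib : I [set x | (gap_fun b x < g x)%N].
  by apply: contrapT => nI; apply: bounded; exists (gap_fun b) => //; exists b.
(* A point of [b] outside the separator has some [n] with [a n x] and [n < g x], so
   [first_index x <= n < g x]. *)
apply: (ideal_subset idI _ Ib) => x [bx /existsNP[n /not_implyP[anx]]] /negP /=.
rewrite -ltnNge /gap_fun asboolT//; exact/leq_ltn_trans/first_index_le.
Qed.

End gap_functions.

(** [bI I] is least only among sets of type [cardinal], so [F] is first copied there by an
    injection. *)
Lemma bI_le {U : Type} {I : set (set nat)} {F : set (nat -> nat)} {L : set U} :
  is_ideal I -> unbounded_family I F -> F #<= L -> bI I #<= L.
Proof.
move=> idI FU FL.
have : F #<= [set: set (set nat)].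
  apply: card_le_trans (card_le_fun_nat F) _.
  exact: card_le_trans continuum_succP.1.1 (card_leT _).
move=> /pcard_leP[j].
have FK : F #= j @` F by rewrite card_eq_sym; apply: inj_card_eq; exact: inj.
apply: card_le_trans ((bIP idI).2 (j @` F) _) _; first by exists F.
exact: card_le_trans (card_image_le j F) FL.
Qed.

Theorem theorem3p2 (I : set (set nat)) (idI : is_ideal I) : bI I #<= bR I.
Proof.
have [[K gK]|nogap] := pselect (omega_gap_cards I !=set0); last first.
  (* Without gaps, [bR I] is c^+, while [DI I] is an unbounded family of size at most c. *)
  rewrite /bR asboolF//; apply: (bI_le idI (unbounded_DI idI)).
  exact: card_le_trans (card_le_fun_nat _) continuum_succP.1.1.
have [A0 [B0 [gAB0 Aw0 _]]] := gK.
(* The gap [gAB0] only shows that gaps exist; the one taken here has [B] of cardinality [bR I]. *)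
have [[A [B [gAB Aw BK]]] _] := bR_gapP gAB0 Aw0.
have [a aA] := card_eq_natP _ _ Aw; rewrite -aA in gAB.
apply: (bI_le idI (gap_fun_unbounded _ _ _ idI gAB)).
apply: card_le_trans (card_image_le _ _) _.
by move: BK; rewrite card_eq_le => /andP[].
Qed.
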